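(* Consider the leaky Abelian sandpile on $\mathbb Z^d\times\{1,\dots,p\}$ under Assumption A, started with $N$ grains at $(0,i_0)$. There exist constants $\alpha,\beta>0$ (independent of $N$ and of the site) such that for every $N\in\{1,2,\dots\}$ and every $(x,i)\in\mathbb Z^d\times\{1,\dots,p\}$: if $G\big((0,i_0),(x,i)\big)>\frac{\alpha}{N}$, then $(x,i)$ is in the shape of the final configuration; if $G\big((0,i_0),(x,i)\big)<\frac{\beta}{N}$, then $(x,i)$ is not in the shape of the final configuration.
   Context: Setting. $d,p\ge1$ are integers. For $x\in\mathbb Z^d$, $i,j\in\{1,\dots,p\}$ let $c(x,i,j)\ge 0$, with $0<\sigma_i:=\sum_{(y,j)}c(y,i,j)<\infty$, and let $m_i\ge1$ be leakiness parameters. Put $\mu_{i,j}(x)=\frac{c(x,i,j)}{m_i\sigma_i}$. The killed random walk (KRW) $(X_n)$ on $(\mathbb Z^d\times\{1,\dots,p\})\sqcup\{\mathsf k\}$ jumps from $(x,i)$ to $(y,j)$ with probability $\mu_{i,j}(y-x)$ and from $(x,i)$ to the absorbing cemetery $\mathsf k$ with probability $1-\frac1{m_i}$. Its Green function is $G((x,i),(y,j))=\sum_{n\ge0}\mathbb P_{(x,i)}(X_n=(y,j))$. Assumption A: (1) $m_i>1$ for at least one $i$; (2) the KRW is irreducible: every $(x,j)$ can be reached from every $(0,i)$ with positive probability in some number $n\ge1$ of steps; (3) it is aperiodic: $\gcd\{n\ge1:\mathbb P_{(x,i)}(X_n=(x,i))>0\}=1$ for all $(x,i)$; (4) $\sum_{x}e^{\gamma\|x\|}\mu_{i,j}(x)<\infty$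 for all $i,j$ and all $\gamma>0$. Sandpile (LASM). A configuration is a function $s:\mathbb Z^d\times\{1,\dots,p\}\to\mathbb R_{\ge0}$. It is stable at $(x,i)$ if $s(x,i)\le m_i\sigma_i$. If it is unstable at $(x,i)$, the site may topple: $s(x,i)$ decreases by $m_i\sigma_i$ and then every $s(y,j)$ increases by $c(y-x,i,j)$. Starting from $N\delta_{(0,i_0)}$, unstable sites are toppled until the configuration is stable; the final configuration and the numbers of topplings do not depend on the order. The odometer of $(x,i)$ is the total mass emitted from $(x,i)$ before stabilization (number of topplings at $(x,i)$ times $m_i\sigma_i$). A site is in the shape of the final configuration if its odometer is positive. *)

(* Defs.v *)
From HB Require Import structures.
From mathcomp Require Import all_boot all_order all_algebra.
From mathcomp Require Import all_classical all_reals all_analysis.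

Set Implicit Arguments.
Unset Strict Implicit.
Unset Printing Implicit Defensive.

Import Order.TTheory GRing.Theory Num.Theory.

Local Open Scope classical_set_scope.
Local Open Scope ring_scope.

Definition site (d p : nat) : Type := ('rV[int]_d * 'I_p)%type.

(* [None] is the cemetery. *)
Definition state (d p : nat) : Type := option (site d p).

Definition euclidean_norm (R : realType) (d : nat) (x : 'rV[int]_d) : R :=
  Num.sqrt (\sum_(k < d) ((x ord0 k)%:~R) ^+ 2).

Definition total_rate (R : realType) (d p : nat)
    (c : 'rV[int]_d -> 'I_p -> 'I_p -> R) (i : 'I_p) : \bar R :=
  (\esum_(z in [set: site d p]) (c z.1 i z.2)%:E)%E.

(* [fine] sends +oo to 0; this is used only when [total_rate c i] is finite. *)
Definition sigma (R : realType) (d p : nat)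
    (c : 'rV[int]_d -> 'I_p -> 'I_p -> R) (i : 'I_p) : R :=
  fine (total_rate c i).

Definition mu (R : realType) (d p : nat)
    (c : 'rV[int]_d -> 'I_p -> 'I_p -> R) (m : 'I_p -> R)
    (i j : 'I_p) (x : 'rV[int]_d) : R :=
  c x i j / (m i * sigma c i).

Definition kernel_krw (R : realType) (d p : nat)
    (c : 'rV[int]_d -> 'I_p -> 'I_p -> R) (m : 'I_p -> R)
    (s t : state d p) : R :=
  match s, t with
  | Some z, Some w => mu c m z.2 w.2 (w.1 - z.1)
  | Some z, None => 1 - (m z.2)^-1
  | None, Some _ => 0
  | None, None => 1
  end.

(* [P z] is the law under which the chain starts at [z].  The third clause is
   the Markov property, with the conditional probability multiplied out so that
   histories of probability zero need no special treatment. *)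
Definition is_krw (R : realType) (d p : nat)
    (c : 'rV[int]_d -> 'I_p -> 'I_p -> R) (m : 'I_p -> R)
    (disp : measure_display) (Omega : measurableType disp)
    (P : site d p -> probability Omega R) (X : nat -> Omega -> state d p) :
    Prop :=
  [/\ forall (n : nat) (s : state d p), measurable [set w | X n w = s],
      forall z : site d p, P z [set w | X 0%N w = Some z] = 1%E
    & forall (z : site d p) (n : nat) (h : nat -> state d p),
        P z [set w | forall k, (k <= n.+1)%N -> X k w = h k] =
        (P z [set w | forall k, (k <= n)%N -> X k w = h k] *
         (kernel_krw c m (h n) (h n.+1))%:E)%E].

Definition green (R : realType) (d p : nat)
    (disp : measure_display) (Omega : measurableType disp)
    (P : site d p -> probability Omega R) (X : nat -> Omega -> state d p)
    (z w : site d p) : \bar R :=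
  (\sum_(0 <= n <oo) P z [set a | X n a = Some w])%E.

Definition irreducible_krw (R : realType) (d p : nat)
    (disp : measure_display) (Omega : measurableType disp)
    (P : site d p -> probability Omega R) (X : nat -> Omega -> state d p) :
    Prop :=
  forall (i j : 'I_p) (x : 'rV[int]_d),
    exists2 n : nat, (1 <= n)%N &
      (0 < P (0%R, i) [set a | X n a = Some (x, j)])%E.

Definition is_gcd_of (A : set nat) (g : nat) : Prop :=
  (forall n, A n -> (g %| n)%N) /\
  (forall k : nat, (forall n, A n -> (k %| n)%N) -> (k %| g)%N).

Definition aperiodic_krw (R : realType) (d p : nat)
    (disp : measure_display) (Omega : measurableType disp)
    (P : site d p -> probability Omega R) (X : nat -> Omega -> state d p) :
    Prop :=
  forall z : site d p,
    is_gcd_of [set n : nat | (1 <= n)%N /\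
                 (0 < P z [set a | X n a = Some z])%E] 1%N.

Definition exponential_moments (R : realType) (d p : nat)
    (c : 'rV[int]_d -> 'I_p -> 'I_p -> R) (m : 'I_p -> R) : Prop :=
  forall (i j : 'I_p) (gamma : R), 0 < gamma ->
    (\esum_(x in [set: 'rV[int]_d])
       (expR (gamma * euclidean_norm R x) * mu c m i j x)%:E < +oo)%E.

Definition assumptionA (R : realType) (d p : nat)
    (c : 'rV[int]_d -> 'I_p -> 'I_p -> R) (m : 'I_p -> R)
    (disp : measure_display) (Omega : measurableType disp)
    (P : site d p -> probability Omega R) (X : nat -> Omega -> state d p) :
    Prop :=
  [/\ exists i : 'I_p, 1 < m i,
      irreducible_krw P X,
      aperiodic_krw P X
    & exponential_moments c m].

(* Nonnegativity of the masses is not part of the type: it holds for the initial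
   configuration and is preserved by toppling unstable sites. *)
Definition config (R : realType) (d p : nat) : Type := site d p -> R.

Definition point_config (R : realType) (d p : nat) (z : site d p) (N : nat) :
    config R d p :=
  fun w => if w == z then N%:R else 0.

Definition stable_at (R : realType) (d p : nat)
    (c : 'rV[int]_d -> 'I_p -> 'I_p -> R) (m : 'I_p -> R)
    (s : config R d p) (z : site d p) : Prop :=
  s z <= m z.2 * sigma c z.2.

Definition topple (R : realType) (d p : nat)
    (c : 'rV[int]_d -> 'I_p -> 'I_p -> R) (m : 'I_p -> R)
    (s : config R d p) (z : site d p) : config R d p :=
  fun w => s w - (if w == z then m z.2 * sigma c z.2 else 0)
           + c (w.1 - z.1) z.2 w.2.

Fixpoint legal (R : realType) (d p : nat)
    (c : 'rV[int]_d -> 'I_p -> 'I_p -> R) (m : 'I_p -> R)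
    (s : config R d p) (l : seq (site d p)) : Prop :=
  match l with
  | [::] => True
  | z :: l' => ~ stable_at c m s z /\ legal c m (topple c m s z) l'
  end.

Definition stabilization (R : realType) (d p : nat)
    (c : 'rV[int]_d -> 'I_p -> 'I_p -> R) (m : 'I_p -> R)
    (s : config R d p) (l : seq (site d p)) : Prop :=
  legal c m s l /\
  forall z : site d p, stable_at c m (foldl (topple c m) s l) z.

Definition odometer (R : realType) (d p : nat)
    (c : 'rV[int]_d -> 'I_p -> 'I_p -> R) (m : 'I_p -> R)
    (l : seq (site d p)) (z : site d p) : R :=
  (count_mem z l)%:R * (m z.2 * sigma c z.2).

(* Shape of the final configuration reached through the toppling sequence [l]. *)
Definition lasm_shape (R : realType) (d p : nat)
    (c : 'rV[int]_d -> 'I_p -> 'I_p -> R) (m : 'I_p -> R)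
    (l : seq (site d p)) : set (site d p) :=
  [set z | 0 < odometer c m l z].

(* Main.v *)
(** Write [Q] for the substochastic kernel of the walk, [u] for the odometer and
  [g = sum_n P(X_n = .)] for the Green function seen from the source.  The final
  configuration is [N delta - u + u Q].  When an unstable site topples, its new
  odometer is less than [N delta + u Q] there, so [u <= N g] persists along any
  legal sequence because [g = delta + g Q]; as [u] is at least one capacity
  [m_i sigma_i] on the shape, this gives [beta].  Conversely stability says
  [N delta + u Q <= u + M] with [M] the capacities, so if [h] depends only on the
  type and [M + h Q <= h], then [N g <= u + h] by induction over partial sums of
  [g]; this gives [alpha].  Such an [h], and the Lyapunov function bounding the
  length of legal sequences, come from the finite matrix of types, which
  irreducibility and one leaky type make transient. *)
Require Import Defs.
From HB Require Import structures.
From mathcomp Require Import all_boot all_order all_algebra.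
From mathcomp Require Import all_classical all_reals all_analysis.
From mathcomp Require Import ring lra.

Set Implicit Arguments.
Unset Strict Implicit.
Unset Printing Implicit Defensive.

Import Order.TTheory GRing.Theory Num.Theory.

Local Open Scope classical_set_scope.
Local Open Scope ring_scope.

(** * Sums over discrete index sets and countable additivity *)

Section Esum.
Variables (R : realType) (T : choiceType).
Implicit Types a : T -> \bar R.

Lemma sum_seq_le_esum a (s : seq T) : (forall x, 0 <= a x)%E -> uniq s ->
  (\sum_(x <- s) a x <= \esum_(x in [set: T]) a x)%E.
Proof.
move=> a0 us; apply: esum_ge; exists [set` s].
  by split=> //; exact: finite_seq.
by rewrite -fsbig_seq.
Qed.

Lemma esum_le_of_seq a (b : \bar R) :
  (forall s : seq T, uniq s -> \sum_(x <- s) a x <= b)%E ->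
  (\esum_(x in [set: T]) a x <= b)%E.
Proof.
move=> H; apply: ge_ereal_sup => _ [D [fD _] <-].
by rewrite fsbig_finite//=; apply: H; exact: finmap.fset_uniq.
Qed.

(** Finite lists give one inequality for every nonnegative factor; the other is the same inequality
    with factor [r^-1], the case [r = 0] being apart. *)
Lemma esumZr a (r : R) : 0 <= r -> (forall x, 0 <= a x)%E ->
  (\esum_(x in [set: T]) (a x * r%:E) = (\esum_(x in [set: T]) a x) * r%:E)%E.
Proof.
have le (b : T -> \bar R) (t : R) : 0 <= t -> (forall x, 0 <= b x)%E ->
    (\esum_(x in [set: T]) (b x * t%:E)
       <= (\esum_(x in [set: T]) b x) * t%:E)%E.
  move=> t0 b0; apply: esum_le_of_seq => s us.
  rewrite -ge0_sume_distrl//; apply: lee_wpmul2r; first by rewrite lee_fin.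
  exact: sum_seq_le_esum.
move=> r0 a0; apply/eqP; rewrite eq_le le//=.
move: r0; rewrite [0 <= r]le_eqVlt => /predU1P[<-|r0].
  by rewrite mule0; apply: esum_ge0 => x _; rewrite mule0.
rewrite -lee_pdivlMr//.
have -> : (\esum_(x in [set: T]) a x =
           \esum_(x in [set: T]) ((a x * r%:E) * r^-1%:E))%E.
  by apply: eq_esum => x _; rewrite -muleA -EFinM divff ?gt_eqF// mule1.
apply: le; first by rewrite invr_ge0 ltW.
by move=> x; rewrite mule_ge0// lee_fin ltW.
Qed.

End Esum.

Lemma measure_esum_fibers (R : realType) (disp : measure_display)
    (Omega : measurableType disp) (P : probability Omega R)
    (T : countType) (Y : Omega -> T) (E : set Omega) : measurable E ->
  (forall v, measurable [set w | Y w = v]) ->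
  P E = (\esum_(v in [set: T]) P (E `&` [set w | Y w = v]))%E.
Proof.
move=> mE mY.
pose D : set nat := [set pickle v | v in [set: T]].
pose F n := E `&` [set w | pickle (Y w) = n].
have FE v : F (pickle v) = E `&` [set w | Y w = v].
  apply/seteqP; split=> w /= [Ew h]; split=> //=; last by rewrite h.
  exact: (pcan_inj pickleK).
have {1}-> : E = \bigcup_(n in D) F n.
  apply/seteqP; split=> [w Ew|w [n _ []]//].
  by exists (pickle (Y w)) => //; exists (Y w).
rewrite measure_bigcup; last 2 first.
- by move=> _ [v _ <-]; rewrite FE; exact: measurableI.
- by move=> i j _ _ [w [[_ /= <-] [_ /= <-]]].
rewrite nneseries_esum//.
rewrite (reindex_esum [set: T] _ (@pickle T)); first last.
  split.
  - by move=> v _ /=; rewrite inE; exists v.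
  - by move=> u v _ _; exact: (pcan_inj pickleK).
  - by move=> n /=; rewrite inE => -[v _ <-]; exists v.
by apply: eq_esum => v _; rewrite FE.
Qed.

(** * Potentials of a finite nonnegative matrix *)

Section Potential.
Variables (R : realFieldType) (p : nat) (A : 'I_p -> 'I_p -> R).
Hypothesis A0 : forall i j, 0 <= A i j.

(** The condition on [D] is transience in combinatorial form: every index leads to a row of sum
    below 1. Hence the decreasing vectors [r n = A^n 1] fall below 1 everywhere, and a multiple of a
    partial sum of the [r n] serves as [f]. *)
Lemma superharmonic_column :
  (forall i, \sum_j A i j <= 1) ->
  (forall D : pred 'I_p, (forall i, \sum_j A i j < 1 -> D i) ->
     (forall i j, 0 < A i j -> D j -> D i) -> forall i, D i) ->
  exists f : 'I_p -> R,
    (forall i, 0 <= f i) /\ (forall i, 1 + \sum_j A i j * f j <= f i).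
Proof.
move=> A1 irr.
pose r n := iter n (fun g i => \sum_j A i j * g j) (fun=> 1 : R).
have rS n i : r n.+1 i = \sum_j A i j * r n j by [].
have r0 n i : 0 <= r n i.
  by elim: n i => [|n IH] i //; rewrite rS sumr_ge0// => j _; rewrite mulr_ge0.
have r_step n i : r n.+1 i <= r n i.
  elim: n i => [|n IH] i.
    by rewrite rS; under eq_bigr do rewrite mulr1; exact: A1.
  by rewrite rS [leRHS]rS ler_sum// => j _; rewrite ler_wpM2l.
have r_le n k i : (n <= k)%N -> r k i <= r n i.
  move=> /subnK <-; elim: (k - n)%N => // q; exact/le_trans/r_step.
(* [irr] is applied to the indices where some [r n] is below 1; a predecessor of such an index loses
   mass one step later. *)
have ex i : exists n, r n i < 1.
  apply/asboolP; move: i; apply: irr => [i|i j] => [h|Aij /asboolP[n rn]].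
    by apply/asboolP; exists 1%N; rewrite rS; under eq_bigr do rewrite mulr1.
  apply/asboolP; exists n.+1; rewrite rS; apply: lt_le_trans (A1 i).
  rewrite (bigD1 j)//= [ltRHS](bigD1 j)//=; apply: ltr_leD.
    by rewrite gtr_pMr.
  by apply: ler_sum => k _; rewrite ler_piMr//; exact: (@r_le 0%N).
have [N rN] : exists N, forall i, r N i < 1.
  pose n i := projT1 (cid (ex i)).
  exists (\max_i n i)%N => i; apply: le_lt_trans (projT2 (cid (ex i))).
  by apply: r_le; exact: (leq_bigmax i).
have rN0 i : 0 < 1 - r N i by rewrite subr_gt0.
(* [f - A f] telescopes to [C] times [1 - r N i]; this [C] makes it at least 1. *)
pose C := \sum_i (1 - r N i)^-1.
have C_ge i : (1 - r N i)^-1 <= C.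
  rewrite /C (bigD1 i)//= lerDl sumr_ge0// => j _.
  by rewrite invr_ge0 ltW.
exists (fun i => C * \sum_(k < N) r k i); split=> i.
  apply: mulr_ge0; last by apply: sumr_ge0.
  by apply: le_trans (C_ge i); rewrite invr_ge0 ltW.
have -> : \sum_j A i j * (C * \sum_(k < N) r k j) =
    C * \sum_(k < N) r k.+1 i.
  rewrite [\sum_(k < N) r k.+1 i](eq_bigr
    (fun k : 'I_N => \sum_j A i j * r k j))//.
  rewrite exchange_big mulr_sumr; apply: eq_bigr => j _.
  by rewrite mulrCA -mulr_sumr.
rewrite -lerBrDr -mulrBr -sumrB.
have -> : \sum_(k < N) (r k i - r k.+1 i) = 1 - r N i.
  have := telescope_sumr (fun k => - r k i) (leq0n N).
  rewrite big_mkord opprK addrC => <-.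
  by apply: eq_bigr => k _; rewrite opprK addrC.
by rewrite -ler_pdivrMr// mul1r.
Qed.

(* Pairing with the superharmonic column [f] makes [A] a strict contraction, so
   that [1 - A] is invertible and the solution has no negative part. *)
Lemma left_potential (f : 'I_p -> R) (b : 'I_p -> R) :
  (forall i, 0 <= f i) -> (forall i, 1 + \sum_j A i j * f j <= f i) ->
  (forall i, 0 <= b i) ->
  exists h : 'I_p -> R,
    (forall j, 0 <= h j) /\ (forall j, h j = b j + \sum_i h i * A i j).
Proof.
move=> f0 fA b0.
(* Pairing [v <= v A] with [f] gives [\sum v f <= \sum v (f - 1)], hence [\sum v <= 0]. *)
have null (v : 'I_p -> R) : (forall j, 0 <= v j) ->
    (forall j, v j <= \sum_i v i * A i j) -> forall j, v j = 0.
  move=> v0 vA.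
  have : \sum_j v j * f j <= \sum_i v i * (f i - 1).
    apply: (@le_trans _ _ (\sum_j (\sum_i v i * A i j) * f j)).
      by apply: ler_sum => j _; rewrite ler_wpM2r.
    under eq_bigr do rewrite mulr_suml.
    rewrite exchange_big; apply: ler_sum => i _ /=.
    under eq_bigr do rewrite -mulrA.
    by rewrite -mulr_sumr ler_wpM2l// lerBrDl.
  under [leRHS]eq_bigr do rewrite mulrBr mulr1.
  rewrite sumrB lerBrDr gerDl => sv j; apply/eqP; rewrite eq_le v0 andbT.
  by apply: le_trans sv; rewrite (bigD1 j)//= lerDl sumr_ge0.
pose B := 1%:M - \matrix_(i, j) A i j : 'M[R]_p.
have vB (v : 'rV_p) j : (v *m B) 0 j = v 0 j - \sum_i v 0 i * A i j.
  rewrite mulmxBr mulmx1 !mxE; congr (_ - _).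
  by apply: eq_bigr => i _; rewrite mxE.
have uB : B \in unitmx.
  rewrite -row_free_unit; apply: inj_row_free => v vB0.
  have vE j : v 0 j = \sum_i v 0 i * A i j.
    by apply/eqP; rewrite -subr_eq0 -vB vB0 mxE.
  apply/rowP => j; rewrite mxE; apply/normr0_eq0; move: j.
  apply: null => // j; rewrite [in leLHS]vE.
  apply: le_trans (ler_norm_sum _ _ _) _; apply: ler_sum => i _.
  by rewrite normrM (ger0_norm (A0 _ _)).
pose w := (\row_j b j) *m invmx B.
have wE j : w 0 j = b j + \sum_i w 0 i * A i j.
  by apply/eqP; rewrite -subr_eq -vB mulmxKV// mxE.
exists (fun j => w 0 j); split=> // j.
(* As [b >= 0], the negative part of [w] is at most its own image under [A], so [null] applies to
   it. *)
have wm : Num.max 0 (- w 0 j) = 0.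
  move: j; apply: null => j; first by rewrite le_max lexx.
  rewrite ge_max sumr_ge0/=; last first.
    by move=> i _; rewrite mulr_ge0// le_max lexx.
  rewrite [in leLHS]wE opprD -sumrN.
  apply: (@le_trans _ _ (\sum_i - (w 0 i * A i j))).
    by rewrite gerDr oppr_le0.
  by apply: ler_sum => i _; rewrite -mulNr ler_wpM2r// le_max lexx orbT.
by rewrite -oppr_le0 -wm le_max lexx orbT.
Qed.

End Potential.

(** * The kernel of the walk and its projection to types *)

Section Kernel.
Variables (R : realType) (d p : nat).
Variables (c : 'rV[int]_d -> 'I_p -> 'I_p -> R) (m : 'I_p -> R).
Hypothesis hc : forall x i j, 0 <= c x i j.
Hypothesis hsigma : forall i, (0 < total_rate c i < +oo)%E.
Hypothesis hm : forall i, 1 <= m i.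

Definition capacity (i : 'I_p) : R := m i * sigma c i.

(** By translation invariance the type of the walk is itself a killed chain, with this transition
    matrix. The sum is finite, so [fine] does not alter it. *)
Definition type_kernel (i j : 'I_p) : R :=
  fine (\esum_(x in [set: 'rV[int]_d]) (mu c m i j x)%:E).

Definition step (y w : site d p) : R := mu c m y.2 w.2 (w.1 - y.1).

Lemma sigma_gt0 i : 0 < sigma c i.
Proof. exact: fine_gt0. Qed.

Lemma m_gt0 i : 0 < m i.
Proof. exact: lt_le_trans (hm i). Qed.

Lemma capacity_gt0 i : 0 < capacity i.
Proof. by rewrite mulr_gt0// (m_gt0, sigma_gt0). Qed.

Lemma mu_ge0 i j x : 0 <= mu c m i j x.
Proof. by rewrite divr_ge0// ltW// capacity_gt0. Qed.

Lemma step_ge0 y w : 0 <= step y w.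
Proof. exact: mu_ge0. Qed.

(** The link between sandpile and walk: a toppling distributes its capacity according to the law of
    one step. *)
Lemma capacity_step y w : capacity y.2 * step y w = c (w.1 - y.1) y.2 w.2.
Proof. by rewrite /step /mu mulrC divfK// gt_eqF// capacity_gt0. Qed.

Lemma total_rate_sum i :
  total_rate c i = (\sum_j \esum_(x in [set: 'rV[int]_d]) (c x i j)%:E)%E.
Proof.
rewrite -esum_sum; last by move=> *; rewrite lee_fin.
transitivity (\esum_(x in [set: 'rV[int]_d])
    \esum_(j in [set: 'I_p]) (c x i j)%:E)%E.
  rewrite esum_esum; last by move=> *; rewrite lee_fin.
  by rewrite /total_rate; congr esum; apply/seteqP; split.
apply: eq_esum => x _.
have -> : [set: 'I_p] = [set` index_enum 'I_p].
  by apply/seteqP; split=> j //= _; rewrite mem_index_enum.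
rewrite esum_fset; first by rewrite -fsbig_seq// index_enum_uniq.
  exact: finite_seq.
by move=> *; rewrite lee_fin.
Qed.

Lemma esum_mu i j :
  (\esum_(x in [set: 'rV[int]_d]) (mu c m i j x)%:E =
   (\esum_(x in [set: 'rV[int]_d]) (c x i j)%:E) * ((capacity i)^-1)%:E)%E.
Proof.
rewrite -esumZr//; last by move=> x; rewrite lee_fin.
by rewrite invr_ge0 ltW// capacity_gt0.
Qed.

Lemma type_kernelE i j :
  (type_kernel i j)%:E = (\esum_(x in [set: 'rV[int]_d]) (mu c m i j x)%:E)%E.
Proof.
rewrite /type_kernel fineK// esum_mu fin_numM// ge0_fin_numE; last first.
  by apply: esum_ge0 => x _; rewrite lee_fin.
have /andP[_] := hsigma i; apply: le_lt_trans; rewrite total_rate_sum.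
rewrite (bigD1 j)//= leeDl// sume_ge0// => k _.
by apply: esum_ge0 => x _; rewrite lee_fin.
Qed.

Lemma type_kernel_ge0 i j : 0 <= type_kernel i j.
Proof. by apply/fine_ge0/esum_ge0 => x _; rewrite lee_fin mu_ge0. Qed.

(** The total rate cancels against the factor [sigma c i] of the capacity; so leaky types are
    exactly the rows with sum below 1. *)
Lemma type_kernel_row i : \sum_j type_kernel i j = (m i)^-1.
Proof.
apply: EFin_inj; rewrite -sumEFin.
under eq_bigr do rewrite type_kernelE esum_mu.
rewrite -ge0_sume_distrl; last first.
  by move=> j _; apply: esum_ge0 => x _; rewrite lee_fin.
rewrite -total_rate_sum -(@fineK _ (total_rate c i)).
  rewrite -EFinM -/(sigma c i) /capacity invfM mulrCA divff ?mulr1//.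
  by rewrite gt_eqF// sigma_gt0.
by have /andP[h0 h1] := hsigma i; rewrite ge0_fin_numE// ltW.
Qed.

Lemma sum_mu_le i j (s : seq 'rV[int]_d) : uniq s ->
  \sum_(x <- s) mu c m i j x <= type_kernel i j.
Proof.
move=> us; rewrite -lee_fin type_kernelE -sumEFin.
by apply: sum_seq_le_esum => // x; rewrite lee_fin mu_ge0.
Qed.

Lemma mu_le_type_kernel i j x : mu c m i j x <= type_kernel i j.
Proof. by have := @sum_mu_le i j [:: x] isT; rewrite big_seq1. Qed.

(** Sites are grouped by type. Within a type [g] is injective, so its values form a duplicate-free
    list. This serves sums over sources and over targets of a step alike. *)
Lemma sum_by_type (a : 'I_p -> 'rV[int]_d -> R) (B : 'I_p -> R)
    (g : site d p -> 'rV[int]_d) (F : seq (site d p)) : uniq F ->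
  (forall i s, uniq s -> \sum_(x <- s) a i x <= B i) ->
  (forall y z, y.2 = z.2 -> g y = g z -> y = z) ->
  \sum_(y <- F) a y.2 (g y) <= \sum_i B i.
Proof.
move=> uF aB gI; rewrite (partition_big (fun y => y.2) predT)//=.
apply: ler_sum => i _.
rewrite -big_filter.
rewrite [leLHS](_ : _ = \sum_(x <- map g [seq y <- F | y.2 == i]) a i x).
  apply: aB; rewrite map_inj_in_uniq ?filter_uniq// => y z.
  rewrite !mem_filter => /andP[/eqP yi _] /andP[/eqP zi _].
  by apply: gI; rewrite yi.
by rewrite big_map !big_filter; apply: eq_bigr => y /eqP ->.
Qed.

Lemma sum_step_to (h : 'I_p -> R) (F : seq (site d p)) w :
  (forall i, 0 <= h i) -> uniq F ->
  \sum_(y <- F) h y.2 * step y w <= \sum_i h i * type_kernel i w.2.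
Proof.
move=> h0 uF.
apply: (@sum_by_type (fun i x => h i * mu c m i w.2 x) _
  (fun y => w.1 - y.1)) => // [i s us|[y i] [z j] /= -> /addrI/oppr_inj-> //].
by rewrite -mulr_sumr ler_wpM2l// sum_mu_le.
Qed.

Lemma sum_step_from (f : 'I_p -> R) (F : seq (site d p)) z :
  (forall i, 0 <= f i) -> uniq F ->
  \sum_(w <- F) step z w * f w.2 <= \sum_j type_kernel z.2 j * f j.
Proof.
move=> f0 uF.
apply: (@sum_by_type (fun j x => mu c m z.2 j x * f j) _
  (fun w => w.1 - z.1)) => // [j s us|[y i] [x j] /= -> /addIr -> //].
by rewrite -mulr_suml ler_wpM2r// sum_mu_le.
Qed.

End Kernel.

(** * Legal toppling sequences and comparison bounds for the odometer *)

Section Sandpile.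
Variables (R : realType) (d p : nat).
Variables (c : 'rV[int]_d -> 'I_p -> 'I_p -> R) (m : 'I_p -> R).
Hypothesis hc : forall x i j, 0 <= c x i j.
Hypothesis hsigma : forall i, (0 < total_rate c i < +oo)%E.
Hypothesis hm : forall i, 1 <= m i.
Implicit Types (s : config R d p) (l : seq (site d p)) (z w : site d p).

Let cap_ge0 i : 0 <= capacity c m i.
Proof. exact/ltW/capacity_gt0. Qed.

Let st_ge0 y w : 0 <= step c m y w.
Proof. exact: step_ge0. Qed.

Definition inflow l w : R := \sum_(z <- l) c (w.1 - z.1) z.2 w.2.

Lemma odometer_ge0 l w : 0 <= odometer c m l w.
Proof. exact: mulr_ge0 (ler0n _ _) (cap_ge0 _). Qed.

Lemma odometer_cons z l w :
  odometer c m (z :: l) w =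
  (if w == z then capacity c m z.2 else 0) + odometer c m l w.
Proof.
rewrite /odometer /= natrD mulrDl eq_sym; congr (_ + _).
by case: eqP => [->|_]; rewrite (mul1r, mul0r).
Qed.

Lemma odometer_rcons z l w :
  odometer c m (rcons l z) w =
  odometer c m l w + (if w == z then capacity c m z.2 else 0).
Proof.
rewrite -cats1 /odometer count_cat natrD mulrDl; congr (_ + _).
by rewrite -/(odometer c m [:: z] w) odometer_cons /odometer/= mul0r addr0.
Qed.

Lemma foldl_topple s l w :
  foldl (topple c m) s l w = s w - odometer c m l w + inflow l w.
Proof.
elim: l s => [|z l IH] s /=.
  by rewrite /inflow big_nil /odometer mul0r subr0 addr0.
rewrite IH /inflow big_cons odometer_cons /topple -/(capacity c m z.2).
set x := if _ then _ else _; set y := c _ _ _; set t := \sum_(_ <- _) _.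
by ring.
Qed.

Lemma legal_rcons s l z : legal c m s (rcons l z) <->
  legal c m s l /\ ~ stable_at c m (foldl (topple c m) s l) z.
Proof.
elim: l s => [|y l IH] s /=; first by split=> -[].
rewrite IH; split=> [[h1 [h2 h3]]|[[h1 h2] h3]]; by split.
Qed.

Lemma inflow_odometer l w :
  inflow l w = \sum_(y <- undup l) odometer c m l y * step c m y w.
Proof.
rewrite /inflow -big_undup_iterop_count; apply: eq_bigr => y _.
rewrite -[LHS]/(c (w.1 - y.1) y.2 w.2 *+ count_mem y l).
by rewrite -(capacity_step hsigma hm)// /odometer -mulrA mulr_natl.
Qed.

(** Only an inequality, since [F] may miss toppled sites; arbitrary [F] are what bounding an [esum]
    requires. *)
Lemma sum_odometer_step l (F : seq (site d p)) w : uniq F ->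
  \sum_(y <- F) odometer c m l y * step c m y w <= inflow l w.
Proof.
move=> uF; elim: l => [|z l IH].
  by rewrite /inflow big_nil big1// => y _; rewrite /odometer !mul0r.
under eq_bigr do rewrite odometer_cons mulrDl.
rewrite big_split /= /inflow big_cons lerD// -(capacity_step hsigma hm)//.
have [zF|zF] := boolP (z \in F); last first.
  rewrite big1_seq => [|y /= yF].
    exact: mulr_ge0 (cap_ge0 _) (st_ge0 _ _).
  by case: eqP yF zF => [-> ->//|]; rewrite mul0r.
rewrite (bigD1_seq z)//= eqxx big1 ?addr0// => y /negbTE ->.
by rewrite mul0r.
Qed.

(** Just before its last toppling [w] held more than the one capacity that this toppling adds to the
    odometer; later topplings only raise the inflow. *)
Lemma legal_odometer_le s l w : (forall w, 0 <= s w) -> legal c m s l ->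
  odometer c m l w <= s w + inflow l w.
Proof.
move=> s0; elim/last_ind: l => [|l z IH].
  by rewrite /odometer mul0r /inflow big_nil addr0.
move=> /legal_rcons[ll /negP]; rewrite -ltNge foldl_topple -/(capacity c m z.2) => Mz.
have le_in : inflow l w <= inflow (rcons l z) w.
  by rewrite /inflow -cats1 big_cat/= lerDl big_seq1.
rewrite odometer_rcons; case: eqP => [->|_].
  apply: le_trans (_ : s z + inflow l z <= _); last first.
    by rewrite lerD2l /inflow -cats1 big_cat/= lerDl big_seq1.
  by lra.
by rewrite addr0; apply: le_trans (IH ll) _; exact: lerD.
Qed.

(** Comparison with a supersolution: a toppling at [z] leaves the odometer there below [s z] plus
    the inflow, and the inflow is bounded through [G] by induction. Extended values let [G] be a
    multiple of the Green series. *)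
Lemma odometer_le s (G : site d p -> \bar R) l :
  (forall w, 0 <= G w)%E -> legal c m s l ->
  (forall w (F : seq (site d p)), uniq F ->
     (s w)%:E + \sum_(y <- F) G y * (step c m y w)%:E <= G w)%E ->
  forall w, ((odometer c m l w)%:E <= G w)%E.
Proof.
move=> G0 + GH; elim/last_ind: l => [|l z IH].
  by move=> _ w; rewrite /odometer mul0r.
move=> /legal_rcons[ll /negP]; rewrite -ltNge foldl_topple -/(capacity c m z.2) => Mz w.
rewrite odometer_rcons; case: eqP => [->|_]; last by rewrite addr0 IH.
apply: le_trans (GH z (undup l) (undup_uniq l)).
apply: (@le_trans _ _ (s z + inflow l z)%:E).
  by rewrite lee_fin; lra.
rewrite EFinD leeD2l// inflow_odometer -sumEFin; apply: lee_sum => y _.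
by rewrite EFinM lee_wpmul2r ?IH// lee_fin.
Qed.

(* Pairing the odometer with the superharmonic [f] bounds the total mass emitted
   by a legal sequence. *)
Lemma emitted_le z0 N (f : 'I_p -> R) l :
  (forall i, 0 <= f i) ->
  (forall i, 1 + \sum_j type_kernel c m i j * f j <= f i) ->
  legal c m (point_config R z0 N) l ->
  \sum_(z <- l) capacity c m z.2 <= N%:R * f z0.2.
Proof.
move=> f0 fA ll.
have s0 w : 0 <= point_config R z0 N w by rewrite /point_config; case: ifP.
have ef : \sum_(w <- undup l) odometer c m l w * f w.2 =
    \sum_(z <- l) capacity c m z.2 * f z.2.
  rewrite -[RHS]big_undup_iterop_count; apply: eq_bigr => y _.
  rewrite -[RHS]/(capacity c m y.2 * f y.2 *+ count_mem y l).
  by rewrite /odometer -mulrA mulr_natl.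
(* The balance [u <= s + u Q] is paired with [f], and then [Q f <= f - 1]. *)
have : \sum_(z <- l) capacity c m z.2 * f z.2 <=
    N%:R * f z0.2 + \sum_(z <- l) capacity c m z.2 * (f z.2 - 1).
  rewrite -ef; apply: (@le_trans _ _
    (\sum_(w <- undup l) (point_config R z0 N w * f w.2 + inflow l w * f w.2))).
    apply: ler_sum => w _; rewrite -mulrDl ler_wpM2r//.
    exact: legal_odometer_le.
  rewrite big_split /= lerD//.
    have [zl|zl] := boolP (z0 \in undup l).
      rewrite (bigD1_seq z0) ?undup_uniq//= {1}/point_config eqxx.
      rewrite big1 ?addr0// => y.
      by rewrite /point_config => /negbTE ->; rewrite mul0r.
    rewrite big1_seq ?mulr_ge0// => y /= yl; rewrite /point_config.
    by case: eqP yl zl => [-> ->//|]; rewrite mul0r.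
  rewrite (eq_bigr (fun w => \sum_(z <- l)
      capacity c m z.2 * (step c m z w * f w.2))); last first.
    move=> w _; rewrite /inflow mulr_suml; apply: eq_bigr => z _.
    by rewrite mulrA capacity_step.
  rewrite exchange_big /=; apply: ler_sum => z _.
  rewrite -mulr_sumr ler_wpM2l //.
  apply: le_trans (sum_step_from _ _ _ _ _ _) _ => //; first exact: undup_uniq.
  by rewrite lerBrDl.
under [X in _ + X]eq_bigr do rewrite mulrBr mulr1.
by rewrite sumrB; lra.
Qed.

(** Otherwise every legal sequence could be extended by an unstable site, up to length [B.+1]. *)
Lemma stabilization_exists s (B : nat) :
  (forall l, legal c m s l -> (size l <= B)%N) ->
  exists l, stabilization c m s l.
Proof.
move=> HB; apply: contrapT => nex.
have [l [ll sl]] : exists l, legal c m s l /\ size l = B.+1.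
  elim: B.+1 => [|n [l [ll <-]]]; first by exists [::].
  have /existsNP[z hz] : ~ forall z, stable_at c m (foldl (topple c m) s l) z.
    by move=> st; apply: nex; exists l.
  by exists (rcons l z); rewrite size_rcons; split=> //; apply/legal_rcons.
by have := HB _ ll; rewrite sl ltnn.
Qed.

(** By stability and the choice of [h], the odometer plus [h] is a supersolution and so dominates
    the iterates [g n]; [h] pays for the mass that stable sites may retain. *)
Lemma odometer_ge s l (h : 'I_p -> R) (g : nat -> site d p -> \bar R) :
  (forall i, 0 <= h i) ->
  (forall j, capacity c m j + \sum_i h i * type_kernel c m i j <= h j) ->
  stabilization c m s l ->
  (forall w, g 0%N w <= 0)%E ->
  (forall n w, g n.+1 w <=
     (s w)%:E + \esum_(y in [set: site d p]) g n y * (step c m y w)%:E)%E ->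
  forall n w, (g n w <= (odometer c m l w + h w.2)%:E)%E.
Proof.
move=> h0 hA [_ st] g0 gS; elim=> [|n IH] w.
  by apply: le_trans (g0 w) _; rewrite lee_fin addr_ge0// odometer_ge0.
apply: le_trans (gS n w) _.
have le_in : (\esum_(y in [set: site d p]) g n y * (step c m y w)%:E <=
    (inflow l w + \sum_i h i * type_kernel c m i w.2)%:E)%E.
  apply: esum_le_of_seq => F uF.
  apply: (@le_trans _ _ (\sum_(y <- F)
      (odometer c m l y * step c m y w + h y.2 * step c m y w)%:E)%E).
    apply: lee_sum => y _; rewrite -mulrDl [leRHS]EFinM lee_wpmul2r//.
    by rewrite lee_fin.
  rewrite sumEFin lee_fin big_split /= lerD//.
    exact: sum_odometer_step.
  exact: sum_step_to.
apply: le_trans (leeD2l _ le_in) _; rewrite -EFinD lee_fin.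
have := st w; rewrite /stable_at foldl_topple -/(capacity c m w.2).
by have := hA w.2; lra.
Qed.

End Sandpile.

(** * One-step evolution and Green function of the killed walk *)

Section KilledWalk.
Variables (R : realType) (d p : nat).
Variables (c : 'rV[int]_d -> 'I_p -> 'I_p -> R) (m : 'I_p -> R).
Hypothesis hc : forall x i j, 0 <= c x i j.
Hypothesis hsigma : forall i, (0 < total_rate c i < +oo)%E.
Hypothesis hm : forall i, 1 <= m i.
Variables (disp : measure_display) (Omega : measurableType disp).
Variables (P : site d p -> probability Omega R) (X : nat -> Omega -> state d p).
Hypothesis hX : is_krw c m P X.

Let st_ge0 y w : 0 <= step c m y w.
Proof. exact: step_ge0. Qed.

Lemma kernel_krw_ge0 (s t : state d p) : 0 <= kernel_krw c m s t.
Proof.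
case: s t => [z|] [w|] //=; first exact: st_ge0.
by rewrite subr_ge0 invf_le1 ?(m_gt0 hm)// hm.
Qed.

Lemma measurable_window (k n : nat) (h : nat -> state d p) :
  measurable [set w | forall j, (k <= j <= n)%N -> X j w = h j].
Proof.
have [mX _ _] := hX.
rewrite [X in measurable X](_ : _ =
  \bigcap_(j in [set j | (k <= j <= n)%N]) [set w | X j w = h j]).
  by apply: bigcap_measurableType => j _; exact: mX.
by apply/seteqP; split.
Qed.

(* Summing over the position at time [k] forgets it. *)
Lemma krw_window (z : site d p) (k n : nat) (h : nat -> state d p) : (k <= n)%N ->
  (P z [set w | forall j, (k <= j <= n.+1)%N -> X j w = h j] =
   P z [set w | forall j, (k <= j <= n)%N -> X j w = h j] *
     (kernel_krw c m (h n) (h n.+1))%:E)%E.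
Proof.
have [mX _ markov] := hX.
elim: k h => [|k IH] h kn; first exact: markov.
(* [hv v] prescribes [v] at time [k]; as [k < n], the kernel factor from time [n] to [n.+1] is
   unchanged. *)
pose hv (v : state d p) j := if j == k then v else h j.
have window b (v : state d p) : (k <= b)%N ->
    [set w | forall j, (k.+1 <= j <= b)%N -> X j w = h j] `&` [set w | X k w = v]
    = [set w | forall j, (k <= j <= b)%N ->
                  X j w = hv v j].
  move=> kb; apply/seteqP; rewrite /hv; split=> w /=.
    move=> [H Xk] j /andP[kj jb]; case: eqP => [->//|/eqP jk].
    by apply: H; rewrite jb andbT ltn_neqAle eq_sym jk.
  move=> H; split=> [j /andP[kj jb]|].
    by rewrite H ?jb ?andbT ?(ltnW kj)// gtn_eqF.
  by rewrite H ?leqnn// eqxx.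
rewrite (measure_esum_fibers (P z) (measurable_window _ _ _) (mX k)).
rewrite (measure_esum_fibers (P z) (measurable_window k.+1 n h) (mX k)).
rewrite -esumZr ?kernel_krw_ge0//.
apply: eq_esum => v _.
rewrite !window ?(ltnW kn) ?(leqW (ltnW kn))// (IH (hv v) (ltnW kn)).
by rewrite /hv !gtn_eqF// leqW.
Qed.

Lemma krw_step (z : site d p) n w :
  (P z [set o | X n.+1 o = Some w] =
   \esum_(y in [set: site d p])
     P z [set o | X n o = Some y] * (step c m y w)%:E)%E.
Proof.
have [mX _ _] := hX.
rewrite (measure_esum_fibers (P z) (mX n.+1 (Some w)) (mX n)).
transitivity (\esum_(s in [set: state d p])
    P z [set o | X n o = s] * (kernel_krw c m s (Some w))%:E)%E.
  apply: eq_esum => s _.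
  pose h j := if j == n then s else Some w.
  have := krw_window z h (leqnn n); rewrite {3 4}/h eqxx gtn_eqF// => E.
  rewrite [X in P z X](_ : _ =
    [set o | forall j, (n <= j <= n.+1)%N -> X j o = h j]).
    rewrite E; congr (P z _ * _)%E; apply/seteqP; split=> o /=.
      by move=> /(_ n); rewrite leqnn /h eqxx => ->.
    by move=> Xn j; rewrite -eqn_leq => /eqP <-; rewrite /h eqxx.
  apply/seteqP; split=> o /=.
    move=> [Xn1 Xn] j /andP[]; rewrite leq_eqVlt /h => /predU1P[<-|nj].
      by rewrite eqxx.
    move=> jn; rewrite gtn_eqF//.
    by have -> : j = n.+1 by apply/eqP; rewrite eqn_leq jn.
  move=> H; split.
    by rewrite H ?leqnSn ?leqnn// /h gtn_eqF.
  by rewrite H ?leqnSn ?leqnn// /h eqxx.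
have K0 (s : state d p) :
    (0 <= P z [set o | X n o = s] * (kernel_krw c m s (Some w))%:E)%E.
  by rewrite mule_ge0// lee_fin kernel_krw_ge0.
(* The cemetery is absorbing, so its term vanishes and the sum runs over sites. *)
rewrite (esumID (range Some)) ?setTI//.
rewrite [X in (_ + X)%E]esum1 ?adde0; last first.
  move=> [y|] /= ny; last by rewrite mule0.
  by exfalso; apply: ny; exists y.
rewrite (reindex_esum [set: site d p] _ Some)//.
Qed.

Lemma krw_start (z w : site d p) :
  P z [set o | X 0%N o = Some w] = (if w == z then 1 else 0)%E.
Proof.
have [mX X0 _] := hX.
case: eqP => [->|wz]; first exact: X0.
apply/eqP; rewrite eq_le measure_ge0 andbT.
have <- : P z (~` [set o | X 0%N o = Some z]) = 0%E.
  by rewrite probability_setC// X0 subee.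
apply: le_measure; rewrite ?inE//; first exact: measurableC.
by move=> o /= -> [].
Qed.

Lemma green_ge0 z w : (0 <= green P X z w)%E.
Proof. by apply: nneseries_ge0. Qed.

(** Splitting off time 0 and applying one step gives [g = delta + g Q]; cutting the sum to [F]
    leaves the inequality that [odometer_le] takes. *)
Lemma green_supersolution z w (F : seq (site d p)) : uniq F ->
  ((if w == z then 1 else 0) +
     \sum_(y <- F) green P X z y * (step c m y w)%:E <= green P X z w)%E.
Proof.
move=> uF; rewrite [leRHS]/green nneseries_recl// krw_start leeD2l//.
rewrite -nneseries_addn//.
under eq_bigr do rewrite muleC -nneseriesZl//.
rewrite -nneseries_sum; last by move=> y j _; rewrite mule_ge0// lee_fin.
apply: lee_nneseries => [n _ _|n _].
  by apply: sume_ge0 => y _; rewrite mule_ge0// lee_fin.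
rewrite addn1 krw_step.
under eq_bigr do rewrite muleC.
by apply: sum_seq_le_esum => // y; rewrite mule_ge0// lee_fin.
Qed.

Lemma green_partial_sum z w n :
  (\sum_(k < n.+1) P z [set o | X k o = Some w] =
   (if w == z then 1 else 0) + \esum_(y in [set: site d p])
      (\sum_(k < n) P z [set o | X k o = Some y]) * (step c m y w)%:E)%E.
Proof.
rewrite big_ord_recl krw_start; congr (_ + _)%E.
under eq_bigr do rewrite krw_step.
rewrite -esum_sum; last by move=> *; rewrite mule_ge0// lee_fin.
by apply: eq_esum => y _; rewrite ge0_sume_distrl.
Qed.

(** If [i] is outside [D], the walk from type [i] never enters [D], since a possible step into [D]
    puts its starting type in [D]. But [D] contains a leaky type, reachable by irreducibility. *)
Lemma type_kernel_connected : (exists i, 1 < m i) -> irreducible_krw P X ->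
  forall D : pred 'I_p,
  (forall i, \sum_j type_kernel c m i j < 1 -> D i) ->
  (forall i j, 0 < type_kernel c m i j -> D j -> D i) -> forall i, D i.
Proof.
move=> [k mk] irr D Drow Dpred i; apply/negPn/negP => nDi.
have Dk : D k by apply: Drow; rewrite type_kernel_row// invf_lt1// (m_gt0 hm).
have never n w : D w.2 -> P (0, i) [set o | X n o = Some w] = 0%E.
  elim: n w => [|n IH] w Dw.
    by rewrite krw_start; case: eqP Dw nDi => // -> /= ->.
  rewrite krw_step esum1// => y _.
  have [Dy|nDy] := boolP (D y.2); first by rewrite IH// mul0e.
  suff -> : step c m y w = 0 by rewrite mule0.
  apply/eqP; rewrite eq_le st_ge0 andbT.
  apply: le_trans (mu_le_type_kernel hc hsigma hm _ _ _) _.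
  by rewrite leNgt; apply: contra nDy => /Dpred; exact.
by have [n _] := irr i k 0; rewrite never// ltxx.
Qed.

End KilledWalk.

(** * Comparison of the shape with level sets of the Green function *)

Theorem proposition21 (R : realType) (d p : nat)
    (hd : (1 <= d)%N) (hp : (1 <= p)%N)
    (c : 'rV[int]_d -> 'I_p -> 'I_p -> R) (m : 'I_p -> R)
    (hc : forall (x : 'rV[int]_d) (i j : 'I_p), 0 <= c x i j)
    (hsigma : forall i : 'I_p, (0 < total_rate c i < +oo)%E)
    (hm : forall i : 'I_p, 1 <= m i)
    (disp : measure_display) (Omega : measurableType disp)
    (P : site d p -> probability Omega R) (X : nat -> Omega -> state d p)
    (hX : is_krw c m P X)
    (hA : assumptionA c m P X)
    (i0 : 'I_p) :
  exists alpha beta : R, [/\ 0 < alpha, 0 < beta &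
    forall N : nat, (1 <= N)%N ->
      (exists l : seq (site d p),
         stabilization c m (point_config R (0%R, i0) N) l) /\
      forall l : seq (site d p),
        stabilization c m (point_config R (0%R, i0) N) l ->
        forall (x : 'rV[int]_d) (i : 'I_p),
          (((alpha / N%:R)%:E < green P X (0%R, i0) (x, i))%E ->
             lasm_shape c m l (x, i))
          /\
          ((green P X (0%R, i0) (x, i) < (beta / N%:R)%:E)%E ->
             ~ lasm_shape c m l (x, i))].
Proof.
case: hA => m1 irr _ _.
pose A := type_kernel c m.
have A0 i j : 0 <= A i j by exact: type_kernel_ge0.
have [f [f0 fA]] : exists f : 'I_p -> R,
    (forall i, 0 <= f i) /\ (forall i, 1 + \sum_j A i j * f j <= f i).
  apply: superharmonic_column => // [i|].
    by rewrite type_kernel_row// invf_le1// (m_gt0 hm).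
  exact: type_kernel_connected hX m1 irr.
have cap0 i : 0 < capacity c m i by exact: capacity_gt0.
have [h [h0 hE]] := left_potential A0 f0 fA (fun i => ltW (cap0 i)).
have hA' j : capacity c m j + \sum_i h i * A i j <= h j by rewrite -hE.
have h_le j : h j <= \sum_i h i.
  by rewrite (bigD1 j)//= lerDl sumr_ge0.
(* The least capacity serves as [beta]: each site of the shape has emitted at least this much. *)
pose i1 := [arg min_(i < i0) capacity c m i]%O.
have beta_le i : capacity c m i1 <= capacity c m i.
  by rewrite /i1; case: arg_minP => // k _; exact.
(* The sum bounds [h] uniformly over types; the added 1 makes [alpha] positive and larger than every
   [h i]. *)
exists (1 + \sum_i h i), (capacity c m i1); split=> //.
  by rewrite ltr_pwDl// sumr_ge0.
move=> N N1.
pose z0 : site d p := (0, i0).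
have N0 : 0 < N%:R :> R by rewrite ltr0n.
pose s := point_config R z0 N.
have sE w : (s w)%:E = (N%:R%:E * (if w == z0 then 1 else 0))%E.
  by rewrite /s /point_config; case: ifP; rewrite ?mule1 ?mule0.
split.
  (* Total emission is at most [N%:R * f i0], and each toppling emits at least [capacity c m i1]. *)
  have [B hB] : exists B : nat, N%:R * f i0 / capacity c m i1 <= B%:R.
    exists (Num.bound (N%:R * f i0 / capacity c m i1)).
    by apply/ltW/archi_boundP/divr_ge0; [exact: mulr_ge0|exact: ltW].
  apply: (@stabilization_exists _ _ _ _ _ _ B) => l ll.
  rewrite -(ler_nat R); apply: le_trans hB; rewrite ler_pdivlMr//.
  apply: le_trans (emitted_le hc hsigma hm f0 fA ll).
  rewrite mulr_natl -count_predT -iter_addr_0 -big_const_seq; exact: ler_sum.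
move=> l ls x i; split=> [aG|Gb].
  rewrite /lasm_shape /= lt_neqAle odometer_ge0// andbT eq_sym.
  apply/negP => /eqP u0.
  have Ng n w : (N%:R%:E * \sum_(k < n) P z0 [set o | X k o = Some w] <=
      (odometer c m l w + h w.2)%:E)%E.
    move: n w.
    apply: (odometer_ge hc hsigma hm h0 hA' ls) => [w|n w].
      by rewrite big_ord0 mule0.
    rewrite (green_partial_sum hc hsigma hm hX).
    have st0 y v : 0 <= step c m y v by exact: step_ge0.
    have S0 y : (0 <= \sum_(k < n) P z0 [set o | X k o = Some y])%E.
      exact: sume_ge0.
    rewrite ge0_muleDr; [|by case: ifP|]; last first.
      by apply: esum_ge0 => y _; rewrite mule_ge0// lee_fin.
    rewrite sE leeD2l// muleC -esumZr ?ler0n//; last first.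
      by move=> y; rewrite mule_ge0// lee_fin.
    by apply: le_esum => y _; rewrite muleC muleA.
  (* The bound is uniform in [n], so it passes to the full series; outside the shape only [h i]
     remains on the right. *)
  have gle : (green P X z0 (x, i) <= (N%:R^-1 * h i)%:E)%E.
    apply: lime_le; first exact: is_cvg_nneseries.
    apply: nearW => n; rewrite big_mkord EFinM lee_pdivlMl//.
    by apply: le_trans (Ng n (x, i)) _; rewrite u0 add0r.
  have := lt_le_trans aG gle; rewrite lte_fin mulrC ltr_pM2l ?invr_gt0//.
  by have := h_le i; lra.
move=> shp.
have : ((capacity c m i1)%:E <= (odometer c m l (x, i))%:E)%E.
  rewrite lee_fin; apply: le_trans (beta_le i) _.
  move: shp; rewrite /lasm_shape /= /odometer -/(capacity c m i).
  rewrite pmulr_lgt0// ltr0n => n0.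
  by apply: ler_peMl; [exact: ltW|rewrite ler1n].
apply/negP; rewrite -ltNge.
apply: (@le_lt_trans _ _ (N%:R%:E * green P X z0 (x, i))%E).
  pose G w := (N%:R%:E * green P X z0 w)%E.
  apply: (odometer_le hc hsigma hm (G := G) _ ls.1) => [w|w F uF].
    by rewrite mule_ge0 ?lee_fin ?(ltW N0)// green_ge0.
  rewrite /G sE; under eq_bigr do rewrite -muleA.
  rewrite -ge0_sume_distrr -?ge0_muleDr.
  - apply: lee_wpmul2l; first by rewrite lee_fin ltW.
    exact: (green_supersolution hc hsigma hm hX).
  - by case: ifP.
  - by apply: sume_ge0 => y _; rewrite mule_ge0 ?green_ge0// lee_fin step_ge0.
  - by move=> y _; rewrite mule_ge0 ?green_ge0// lee_fin step_ge0.
by rewrite -lte_pdivlMl// -EFinM mulrC.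
Qed.
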